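(* Let $p,q,r$ be atoms. Consider the modified interpretation $\llbracket-\rrbracket'$ which agrees with $\llbracket-\rrbracket$ except that disjunction is interpreted by the coproduct of presheaves: $\llbracket\phi\vee\psi\rrbracket'=\llbracket\phi\rrbracket'+\llbracket\psi\rrbracket'$ (pointwise disjoint union). Then there is a natural transformation from $\llbracket p\supset(q\vee r)\rrbracket'$ to $\llbracket(p\supset q)\vee(p\supset r)\rrbracket'$.
   Context: Fix a countable set $\mathbb A$ of atoms. An atomic rule is $\mathcal R=((P_1\Rightarrow q_1),\dots,(P_n\Rightarrow q_n))\Rightarrow r$ with $n\ge0$, $P_i$ finite sets of atoms, $q_i,r$ atoms (conclude $r$ from premisses $q_i$, each derived with extra discharged hypotheses $P_i$). A base is a countable set of atomic rules. A context $(X:P)$ is a finite list $x_1:p_1,\dots,x_m:p_m$ of distinct variables with atoms. Derivation terms are $\Phi::=x\mid\Phi_{\mathcal R}(\Phi_1,\dots,\Phi_n)$; derivations in a base $\mathcal B$ are generated by $(X:P),x:p\vdash_{\mathcal B}x:p$ and, for $\mathcal R\in\mathcal B$, from $(X:P),(X_i:P_i)\vdash_{\mathcal B}\Phi_i:q_i$ ($i=1..n$) infer $(X:P)\vdash_{\mathcal B}\Phi_{\mathcal R}(\Phi_1,\dots,\Phi_n):r$ (the $X_i$ bound). The category $\mathcal W$ has objects $(\mathcal B,(X:P))$; a morphism $(\mathcal B,(X:P))\to(\mathcal C,(Y:Q))$, $Y:Q=y_1:q_1,\dots,y_m:q_m$, exists only when $\mathcal C\subseteq\mathcal B$ and is a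 tuple of derivations $(X:P)\vdash_{\mathcal B}\Phi_i:q_i$; identities are variable tuples, composition is simultaneous substitution. For presheaves $F,G$ on $\mathcal W$: $F\times G$ pointwise; $(F\supset G)(w)$ = natural transformations $\mathcal W(-,w)\times F\to G$. The interpretation $\llbracket-\rrbracket$: $\llbracket p\rrbracket(\mathcal B,(X:P))$ = set of derivations $(X:P)\vdash_{\mathcal B}\Phi:p$, a morphism $(\Phi_1,\dots,\Phi_m)$ acting by $\Phi\mapsto\Phi[\Phi_1/y_1,\dots,\Phi_m/y_m]$; $\llbracket\phi\wedge\psi\rrbracket=\llbracket\phi\rrbracket\times\llbracket\psi\rrbracket$; $\llbracket\phi\supset\psi\rrbracket=\llbracket\phi\rrbracket\supset\llbracket\psi\rrbracket$; $\llbracket\bot\rrbracket=\prod_{p\in\mathbb A}\llbracket p\rrbracket$ (and originally $\llbracket\phi\vee\psi\rrbracket=\prod_{p}((\llbracket\phi\rrbracket\supset\llbracket p\rrbracket)\supset((\llbracket\psi\rrbracket\supset\llbracket p\rrbracket)\supset\llbracket p\rrbracket))$, replaced here by the coproduct). *)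

(* Defs.v *)
From mathcomp Require Import all_boot finmap.
From Stdlib Require List.
From Stdlib Require Import FunctionalExtensionality ProofIrrelevance.

Set Implicit Arguments.
Unset Strict Implicit.
Unset Printing Implicit Defensive.

(** * Categories and presheaves *)

Record category := Category {
  obj :> Type;
  hom : obj -> obj -> Type;
  idm : forall u, hom u u;
  compm : forall u v w, hom v w -> hom u v -> hom u w;
  compm_idl : forall u v (f : hom u v), compm (idm v) f = f;
  compm_idr : forall u v (f : hom u v), compm f (idm u) = f;
  compm_assoc : forall t u v w (h : hom v w) (g : hom u v) (f : hom t u),
    compm h (compm g f) = compm (compm h g) f
}.
Arguments hom {c} u v.
Arguments idm {c} u.
Arguments compm {c u v w} g f.

Record presheaf (C : category) := Presheaf {
  fib :> C -> Type;
  act : forall u v, hom u v -> fib v -> fib u;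
  act_id : forall u (x : fib u), act (idm u) x = x;
  act_comp : forall u v w (g : hom v w) (f : hom u v) (x : fib w),
    act (compm g f) x = act f (act g x)
}.
Arguments act {C} p {u v} f x.

Record nat_trans (C : category) (F G : presheaf C) := NatTrans {
  component :> forall u, F u -> G u;
  naturality : forall u v (f : hom u v) (x : F v),
    component (act F f x) = act G f (component x)
}.
Arguments component {C F G} n u x.

Lemma nat_trans_eq (C : category) (F G : presheaf C) (a b : nat_trans F G) :
  (forall u x, a u x = b u x) -> a = b.
Proof.
case: a b => [a na] [b nb] /= ab.
have e : a = b.
  by apply: functional_extensionality_dep => u; apply: functional_extensionality.
by subst b; congr NatTrans; exact: proof_irrelevance.
Qed.

Definition yoneda (C : category) (w : C) : presheaf C.
Proof.
refine (@Presheaf C (fun u => hom u w) (fun u v f g => compm g f) _ _).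
- by move=> u x; exact: compm_idr.
- by move=> u v t g f x; exact: compm_assoc.
Defined.

Definition prod_psh (C : category) (F G : presheaf C) : presheaf C.
Proof.
refine (@Presheaf C (fun u => F u * G u)%type
  (fun u v f x => (act F f x.1, act G f x.2)) _ _).
- by move=> u [x y]; rewrite /= !act_id.
- by move=> u v w g f [x y]; rewrite /= !act_comp.
Defined.

Definition coprod_psh (C : category) (F G : presheaf C) : presheaf C.
Proof.
refine (@Presheaf C (fun u => F u + G u)%type
  (fun u v f x => match x with
                  | inl y => inl (act F f y)
                  | inr z => inr (act G f z)
                  end) _ _).
- by move=> u [x|x]; rewrite act_id.
- by move=> u v w g f [x|x]; rewrite act_comp.
Defined.

Definition bigprod_psh (C : category) (I : Type) (F : I -> presheaf C) :
  presheaf C.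
Proof.
refine (@Presheaf C (fun u => forall i, F i u)
  (fun u v f x i => act (F i) f (x i)) _ _).
- by move=> u x; apply: functional_extensionality_dep => i; exact: act_id.
- by move=> u v w g f x; apply: functional_extensionality_dep => i; exact: act_comp.
Defined.

Definition exp_act (C : category) (F G : presheaf C) (u v : C) (f : hom u v)
    (a : nat_trans (prod_psh (yoneda v) F) G) :
  nat_trans (prod_psh (yoneda u) F) G.
Proof.
refine (@NatTrans C (prod_psh (yoneda u) F) G
  (fun t hx => a t (compm f hx.1, hx.2)) _).
by move=> s t g [h x]; rewrite /= compm_assoc -naturality.
Defined.

Definition exp_psh (C : category) (F G : presheaf C) : presheaf C.
Proof.
refine (@Presheaf C (fun w => nat_trans (prod_psh (yoneda w) F) G)
  (@exp_act C F G) _ _).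
- by move=> u a; apply: nat_trans_eq => t [h x]; rewrite /= compm_idl.
- by move=> u v w g f a; apply: nat_trans_eq => t [h x]; rewrite /= compm_assoc.
Defined.

(** * Atomic systems *)

(* [(ps, r)] is the rule [((P_1 => q_1), ..., (P_n => q_n)) => r], where
   [ps] lists the pairs [(P_i, q_i)]. *)
Definition rule (A : countType) := (seq ({fset A} * A) * A)%type.

Definition premisses (A : countType) (R : rule A) : seq ({fset A} * A) := R.1.
Definition conclusion (A : countType) (R : rule A) : A := R.2.

(* As [rule A] is a [countType], every set of rules is countable. *)
Definition base (A : countType) := rule A -> Prop.
Definition base_sub (A : countType) (C B : base A) : Prop :=
  forall R, C R -> B R.

Definition var := nat.

Record context (A : countType) := Context {
  decls :> seq (var * A);
  decls_uniq : uniq (unzip1 decls)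
}.

(* Derivation terms up to renaming of bound variables, in locally nameless
   style: [Free x] is the variable [x] of the ambient context, and [Bound k a]
   is the variable bound for the atom [a] in the discharged context [X_i : P_i]
   of the [k]-th enclosing premiss (counting outwards from 0). Since [P_i] is a
   set, the atom determines the bound variable. Bound variables are indices, not
   levels, so substituting terms without dangling [Bound] needs no shifting. *)
Unset Elimination Schemes.
Inductive term (A : countType) : Type :=
| Free of var
| Bound of nat & A
| App of rule A & seq (term A).
Set Elimination Schemes.
Arguments Free {A} x.
Arguments Bound {A} k a.
Arguments App {A} R ts.

Lemma term_ind (A : countType) (P : term A -> Prop) :
  (forall x, P (Free x)) ->
  (forall k a, P (Bound k a)) ->
  (forall R ts, List.Forall P ts -> P (App R ts)) ->
  forall t, P t.
Proof.
move=> hF hB hA; fix IH 1 => -[x|k a|R ts]; [exact: hF|exact: hB|].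
apply: hA; elim: ts => [|t ts IHts]; constructor; [exact: IH|exact: IHts].
Qed.

(* [derives B X D t p]: [t : p] is derivable in [B] from the context [X]
   extended by one context for each set in [D], innermost first. Thus
   [(X : P) |-_B t : p] is [derives B X [::] t p]. *)
Inductive derives (A : countType) (B : base A) (X : context A) :
  seq {fset A} -> term A -> A -> Prop :=
| DFree D x p :
    (x, p) \in decls X -> derives B X D (Free x) p
| DBound D k p :
    p \in nth fset0 D k -> derives B X D (Bound k p) p
| DApp D R ts :
    B R ->
    List.Forall2 (fun Pq t => derives B X (Pq.1 :: D) t Pq.2) (premisses R) ts ->
    derives B X D (App R ts) (conclusion R).

Record derivation (A : countType) (B : base A) (X : context A) (p : A) :=
  Derivation {
    dterm :> term A;
    dtermP : derives B X [::] dterm p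
  }.

Fixpoint subst (A : countType) (s : var -> term A) (t : term A) : term A :=
  match t with
  | Free x => s x
  | Bound k a => Bound k a
  | App R ts => App R (map (subst s) ts)
  end.

(* The assignment [ts_1/y_1, ..., ts_m/y_m] for [Y = y_1:q_1, ..., y_m:q_m]. *)
Definition assign (A : countType) (Y : context A) (ts : seq (term A)) (y : var) :
  term A :=
  nth (Free y) ts (index y (unzip1 Y)).

Lemma dterm_inj (A : countType) (B : base A) (X : context A) (p : A)
    (d e : derivation B X p) :
  dterm d = dterm e -> d = e.
Proof.
case: d e => [d dP] [e eP] /= de; subst e; congr Derivation.
exact: proof_irrelevance.
Qed.

Lemma subst_comp (A : countType) (s s' : var -> term A) (t : term A) :
  subst s (subst s' t) = subst (fun x => subst s (s' x)) t.
Proof.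
elim: t => //= R ts IH; congr App; elim: ts / IH => //= t ts -> _ ->; done.
Qed.

Lemma subst_Free (A : countType) (t : term A) : subst Free t = t.
Proof.
by elim: t => //= R ts IH; congr App; elim: ts / IH => //= t ts -> _ ->.
Qed.

Lemma derives_FreeE (A : countType) (B : base A) (X : context A)
    (D : seq {fset A}) (x : var) (p : A) :
  derives B X D (Free x) p -> (x, p) \in decls X.
Proof. by move=> dt; inversion dt. Qed.

Lemma derives_BoundE (A : countType) (B : base A) (X : context A)
    (D : seq {fset A}) (k : nat) (a p : A) :
  derives B X D (Bound k a) p -> a = p /\ p \in nth fset0 D k.
Proof. by move=> dt; inversion dt. Qed.

Lemma derives_AppE (A : countType) (B : base A) (X : context A)
    (D : seq {fset A}) (R : rule A) (ts : seq (term A)) (p : A) :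
  derives B X D (App R ts) p ->
  [/\ B R, conclusion R = p &
     List.Forall2 (fun Pq t => derives B X (Pq.1 :: D) t Pq.2) (premisses R) ts].
Proof. by move=> dt; inversion dt. Qed.

Lemma eq_subst (A : countType) (B : base A) (X : context A) (s s' : var -> term A)
    (D : seq {fset A}) (t : term A) (p : A) :
  {in unzip1 X, s =1 s'} -> derives B X D t p -> subst s t = subst s' t.
Proof.
move=> ss'; elim: t D p => [x|k a|R ts IH] D p //=.
  by move/derives_FreeE=> xX; apply: ss'; apply/mapP; exists (x, p).
case/derives_AppE=> _ _ dts; congr App; move: (premisses R) dts => ps.
elim: ts / IH ps => [|t ts IHt _ IHts] //= [|Pq ps].
  by move=> dts; inversion dts.
by case/List.Forall2_cons_iff=> d ds; rewrite (IHt _ _ d) (IHts _ ds).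
Qed.

Lemma derives_weak (A : countType) (B : base A) (X : context A)
    (D E : seq {fset A}) (t : term A) (p : A) :
  derives B X D t p -> derives B X (D ++ E) t p.
Proof.
elim: t D p => [x|k a|R ts IH] D p.
- by move/derives_FreeE; exact: DFree.
- case/derives_BoundE=> -> pD; apply: DBound; rewrite nth_cat; case: ltnP => // lk.
  by move: pD; rewrite nth_default.
case/derives_AppE=> BR <- dts; apply: DApp => //.
move: (premisses R) dts => ps; elim: ts / IH ps => [|t ts IHt _ IHts] [|Pq ps] dts;
  try by inversion dts.
case/List.Forall2_cons_iff: dts => d ds.
by constructor; [exact: IHt d|exact: IHts].
Qed.

Lemma derives_subst (A : countType) (B C : base A) (X Y : context A)
    (s : var -> term A) (D : seq {fset A}) (t : term A) (p : A) :
  base_sub C B ->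
  (forall y q, (y, q) \in decls Y -> derives B X [::] (s y) q) ->
  derives C Y D t p -> derives B X D (subst s t) p.
Proof.
move=> CB sP; elim: t D p => [x|k a|R ts IH] D p /=.
- by move/derives_FreeE/sP; exact: derives_weak.
- by case/derives_BoundE=> ->; exact: DBound.
case/derives_AppE=> CR <- dts; apply: DApp; first exact: CB.
move: (premisses R) dts => ps; elim: ts / IH ps => [|t ts IHt _ IHts] [|Pq ps] dts;
  try by inversion dts.
case/List.Forall2_cons_iff: dts => d ds /=.
by constructor; [exact: IHt|exact: IHts].
Qed.

(** * The category of worlds *)

Record world (A : countType) := World {
  wbase : base A;
  wctx : context A
}.

Record whom (A : countType) (w v : world A) := WHom {
  hom_sub : base_sub (wbase v) (wbase w);
  hom_terms : (size (wctx v)).-tuple (term A);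
  hom_termsP : forall i : 'I_(size (wctx v)),
    derives (wbase w) (wctx w) [::] (tnth hom_terms i)
      (tnth (in_tuple (wctx v)) i).2
}.

Definition hom_assign (A : countType) (w v : world A) (f : whom w v) :
  var -> term A :=
  assign (wctx v) (hom_terms f).

Lemma whom_eq (A : countType) (w v : world A) (f g : whom w v) :
  hom_terms f = hom_terms g -> f = g.
Proof.
case: f g => [fs ft fP] [gs gt gP] /= e; subst gt.
by rewrite (proof_irrelevance _ fs gs) (proof_irrelevance _ fP gP).
Qed.

Lemma assign_tnth (A : countType) (Y : context A) (ts : (size Y).-tuple (term A))
    (i : 'I_(size Y)) :
  assign Y ts (tnth (in_tuple Y) i).1 = tnth ts i.
Proof.
rewrite /assign; set e := tnth _ i.
have -> : e.1 = nth e.1 (unzip1 Y) i by rewrite (nth_map e) // {1}/e (tnth_nth e).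
by rewrite index_uniq ?size_map ?decls_uniq // -tnth_nth.
Qed.

Lemma assign_map (A : countType) (Y : context A) (ts : (size Y).-tuple (term A))
    (g : term A -> term A) :
  {in unzip1 Y, assign Y (map g ts) =1 g \o assign Y ts}.
Proof.
move=> y yY; rewrite /assign /= (nth_map (Free y)) //.
by rewrite size_tuple -(size_map fst) index_mem.
Qed.

Lemma hom_assignP (A : countType) (w v : world A) (f : whom w v) y q :
  (y, q) \in decls (wctx v) ->
  derives (wbase w) (wctx w) [::] (hom_assign f y) q.
Proof.
case/seq_tnthP=> i e.
have := hom_termsP f i; rewrite -assign_tnth.
by rewrite -e.
Qed.

Definition wid (A : countType) (w : world A) : whom w w.
Proof.
refine (@WHom A w w (fun R h => h)
  [tuple Free (tnth (in_tuple (wctx w)) i).1 | i < size (wctx w)] _).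
move=> i; rewrite tnth_mktuple; apply: DFree.
by rewrite -surjective_pairing; exact: (mem_tnth i (in_tuple _)).
Defined.

Definition wcomp (A : countType) (u v w : world A) (g : whom v w) (f : whom u v) :
  whom u w.
Proof.
refine (@WHom A u w (fun R h => hom_sub f (hom_sub g h))
  (map_tuple (subst (hom_assign f)) (hom_terms g)) _).
move=> i; rewrite tnth_map.
exact: (derives_subst (hom_sub f) (@hom_assignP A u v f) (hom_termsP g i)).
Defined.

Lemma hom_assign_id (A : countType) (w : world A) y : hom_assign (wid w) y = Free y.
Proof.
case: (boolP (y \in unzip1 (wctx w))) => [|yw].
  case/mapP=> e /seq_tnthP[i ->] ->.
  by rewrite /hom_assign assign_tnth tnth_mktuple.
rewrite /hom_assign /assign nth_default // size_tuple.
by rewrite leqNgt -(size_map fst) index_mem.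
Qed.

Lemma hom_assign_comp (A : countType) (u v w : world A) (g : whom v w)
    (f : whom u v) :
  {in unzip1 (wctx w),
    hom_assign (wcomp g f) =1 subst (hom_assign f) \o hom_assign g}.
Proof. exact: assign_map. Qed.

Definition W (A : countType) : category.
Proof.
refine (@Category (world A) (@whom A) (@wid A) (@wcomp A) _ _ _).
- move=> u v f; apply: whom_eq; apply: eq_from_tnth => i.
  by rewrite /= tnth_map tnth_mktuple /=; exact: assign_tnth.
- move=> u v f; apply: whom_eq; apply: eq_from_tnth => i; rewrite tnth_map.
  by rewrite (functional_extensionality _ _ (@hom_assign_id A u)) subst_Free.
- move=> t u v w h g f; apply: whom_eq; apply: eq_from_tnth => i.
  rewrite !tnth_map subst_comp.
  exact: (eq_subst (hom_assign_comp g f) (hom_termsP h i)).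
Defined.

(** * Formulas and their interpretation *)

Inductive formula (A : countType) : Type :=
| Atom of A
| Bot
| And of formula A & formula A
| Or of formula A & formula A
| Imp of formula A & formula A.
Arguments Bot {A}.

Definition datom_act (A : countType) (p : A) (u v : W A) (f : hom u v)
    (d : derivation (wbase v) (wctx v) p) : derivation (wbase u) (wctx u) p :=
  Derivation (derives_subst (hom_sub f) (@hom_assignP A u v f) (dtermP d)).

Definition atom_psh (A : countType) (p : A) : presheaf (W A).
Proof.
refine (@Presheaf (W A) (fun w => derivation (wbase w) (wctx w) p)
  (@datom_act A p) _ _).
- move=> u d; apply: dterm_inj => /=.
  by rewrite (functional_extensionality _ _ (@hom_assign_id A u)) subst_Free.
- move=> u v w g f d; apply: dterm_inj; rewrite /= subst_comp.
  exact: (eq_subst (hom_assign_comp g f) (dtermP d)).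
Defined.

(* The interpretation, parametrised by the clause for disjunction. *)
Fixpoint interp_with (A : countType)
    (disj : presheaf (W A) -> presheaf (W A) -> presheaf (W A))
    (phi : formula A) : presheaf (W A) :=
  match phi with
  | Atom p => atom_psh p
  | Bot => bigprod_psh (@atom_psh A)
  | And phi psi => prod_psh (interp_with disj phi) (interp_with disj psi)
  | Or phi psi => disj (interp_with disj phi) (interp_with disj psi)
  | Imp phi psi => exp_psh (interp_with disj phi) (interp_with disj psi)
  end.

Definition atomic_disj (A : countType) (F G : presheaf (W A)) : presheaf (W A) :=
  bigprod_psh (fun p : A =>
    exp_psh (exp_psh F (atom_psh p))
      (exp_psh (exp_psh G (atom_psh p)) (atom_psh p))).

Definition interp (A : countType) : formula A -> presheaf (W A) :=
  interp_with (@atomic_disj A).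

Definition interp' (A : countType) : formula A -> presheaf (W A) :=
  interp_with (@coprod_psh (W A)).

(* Main.v *)
Require Import Defs.
From mathcomp Require Import all_boot.

(** A presheaf generated by a single element maps into one summand of any
    coproduct: naturality transports the summand of the generator to every
    other element. Each product [W(-, w) x [[p]]] is generated by a single
    element, namely, for [w = (B, X : P)], the projection
    [(B, (X : P, x : p)) -> w] paired with the fresh variable [x]. So every
    element of [[[p > (q \/ r)]]] lands entirely in [[[q]]] or entirely in
    [[[r]]]. *)

Set Implicit Arguments.
Unset Strict Implicit.
Unset Printing Implicit Defensive.

(** By Yoneda, such an [F] is a quotient of the representable presheaf at [gen_obj]. *)
Record cyclic (C : category) (F : presheaf C) := Cyclic {
  gen_obj : C;
  gen : F gen_obj;
  genP : forall u (x : F u), exists k : hom u gen_obj, x = act F k gen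
}.

Definition get_inl (S T : Type) (x : S + T) : is_inl x -> S :=
  match x with
  | inl y => fun=> y
  | inr _ => fun h => False_rect S (notF h)
  end.

Definition get_inr (S T : Type) (x : S + T) : ~~ is_inl x -> T :=
  match x with
  | inl _ => fun h => False_rect T (notF h)
  | inr y => fun=> y
  end.

Lemma get_inlK (S T : Type) (x : S + T) (h : is_inl x) : x = inl (get_inl h).
Proof. by case: x h. Qed.

Lemma get_inrK (S T : Type) (x : S + T) (h : ~~ is_inl x) : x = inr (get_inr h).
Proof. by case: x h. Qed.

Lemma factor_inl (C : category) (F G H : presheaf C)
    (a : nat_trans F (coprod_psh G H)) :
  (forall u x, is_inl (a u x)) ->
  {b : nat_trans F G | forall u x, a u x = inl (b u x)}.
Proof.
move=> ha; have nb u v (f : hom u v) (x : F v) :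
    get_inl (ha u (act F f x)) = act G f (get_inl (ha v x)).
  (* As [inl] is injective, the equation may be checked in the coproduct, where it is naturality of
     [a]. *)
  suff: inl (get_inl (ha u (act F f x))) = act (coprod_psh G H) f (a v x).
    by move: (ha v x); case: (a v x) => //= y _ [].
  by rewrite -get_inlK naturality.
by exists (NatTrans nb) => u x; exact: get_inlK.
Qed.

Lemma factor_inr (C : category) (F G H : presheaf C)
    (a : nat_trans F (coprod_psh G H)) :
  (forall u x, ~~ is_inl (a u x)) ->
  {b : nat_trans F H | forall u x, a u x = inr (b u x)}.
Proof.
move=> ha; have nb u v (f : hom u v) (x : F v) :
    get_inr (ha u (act F f x)) = act H f (get_inr (ha v x)).
  suff: inr (get_inr (ha u (act F f x))) = act (coprod_psh G H) f (a v x).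
    by move: (ha v x); case: (a v x) => //= y _ [].
  by rewrite -get_inrK naturality.
by exists (NatTrans nb) => u x; exact: get_inrK.
Qed.

(** Restriction never changes the summand, so the boolean tag at the generator decides. The result
    is a sum of types, not a proposition, so that a map can be defined from it. *)
Lemma cyclic_coprod (C : category) (F G H : presheaf C)
    (a : nat_trans F (coprod_psh G H)) :
  cyclic F ->
  {b : nat_trans F G | forall u x, a u x = inl (b u x)} +
  {c : nat_trans F H | forall u x, a u x = inr (c u x)}.
Proof.
case=> w g gP; have tagE u x : is_inl (a u x) = is_inl (a w g).
  by have [k ->] := gP u x; rewrite naturality /=; case: (a w g).
case: (boolP (is_inl (a w g))) => ag.
- by left; apply: factor_inl => u x; rewrite tagE.
- by right; apply: factor_inr => u x; rewrite tagE.
Qed.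

Lemma exp_coprod (C : category) (F G H : presheaf C) :
  (forall w, cyclic (prod_psh (yoneda w) F)) ->
  nat_trans (exp_psh F (coprod_psh G H))
    (coprod_psh (exp_psh F G) (exp_psh F H)).
Proof.
move=> cF.
refine (@NatTrans C (exp_psh F (coprod_psh G H))
  (coprod_psh (exp_psh F G) (exp_psh F H))
  (fun w a => match cyclic_coprod a (cF w) with
              | inl b => inl (sval b)
              | inr c => inr (sval c)
              end) _).
move=> u v f a.
(* [b] factors the restriction of [a] along [f], and [c] factors [a] itself. The mixed cases are
   absurd: the generator over [u] is an actual element, and its image would lie in both summands. *)
case: cyclic_coprod => -[b bP]; case: cyclic_coprod => -[c cP] /=.
- congr inl; apply: nat_trans_eq => t hx.
  by have := bP t hx; rewrite /= cP => -[].
- by have := bP _ (gen (cF u)); rewrite /= cP.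
- by have := bP _ (gen (cF u)); rewrite /= cP.
- congr inr; apply: nat_trans_eq => t hx.
  by have := bP t hx; rewrite /= cP => -[].
Qed.

Definition fresh (A : countType) (X : context A) : var :=
  (\max_(x <- unzip1 X) x).+1.

Lemma fresh_notin (A : countType) (X : context A) : fresh X \notin unzip1 X.
Proof.
apply/negP => xX; have := @leq_bigmax_seq _ _ xpredT id _ xX isT.
by rewrite ltnn.
Qed.

Lemma extend_uniq (A : countType) (X : context A) (p : A) :
  uniq (unzip1 ((fresh X, p) :: decls X)).
Proof. by rewrite /= fresh_notin decls_uniq. Qed.

Definition extend (A : countType) (w : world A) (p : A) : world A :=
  World (wbase w) (Context (extend_uniq (wctx w) p)).

Definition proj (A : countType) (w : world A) (p : A) : whom (extend w p) w.
Proof.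
(* Variables of [w] keep their names in the extension, so the identity tuple also serves as the
   projection. *)
refine (@WHom A (extend w p) w (fun R h => h) (hom_terms (wid w)) _).
move=> i; rewrite tnth_mktuple; apply: DFree.
by rewrite -surjective_pairing inE (mem_tnth i (in_tuple _)) orbT.
Defined.

Definition fresh_var (A : countType) (w : world A) (p : A) :
  derivation (wbase (extend w p)) (wctx (extend w p)) p :=
  Derivation (@DFree A _ (wctx (extend w p)) [::] _ _ (mem_head _ _)).

Definition pair_hom (A : countType) (u w : world A) (p : A) (h : whom u w)
    (d : derivation (wbase u) (wctx u) p) : whom u (extend w p).
Proof.
refine (@WHom A u (extend w p) (hom_sub h) (cons_tuple (dterm d) (hom_terms h)) _).
(* Index 0 is the fresh variable, which receives [d]; the index lifted from [j] receives entry [j]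
   of [h]. *)
move=> i; case: (unliftP ord0 i) => [j|] ->.
- rewrite !(tnth_nth (fresh (wctx w), p)) !(tnth_nth (Free 0)) /=.
  have := hom_termsP h j.
  by rewrite !(tnth_nth (fresh (wctx w), p)) !(tnth_nth (Free 0)).
- by rewrite !(tnth_nth (fresh (wctx w), p)) !(tnth_nth (Free 0)) /=; case: d.
Defined.

Lemma atom_cyclic (A : countType) (p : A) (w : W A) :
  cyclic (prod_psh (yoneda w) (atom_psh p)).
Proof.
refine (@Cyclic _ (prod_psh (yoneda w) (atom_psh p)) (extend w p)
  (proj w p, fresh_var w p) _).
move=> u [h d]; exists (pair_hom h d); congr pair.
- apply: whom_eq; apply: eq_from_tnth => i; rewrite tnth_map tnth_mktuple /=.
  rewrite -assign_tnth /hom_assign /assign /=.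
  (* The lookup passes over the head entry [d], since a variable declared in [w] differs from the
     fresh one. *)
  case: eqP => // e; case/negP: (fresh_notin (wctx w)); rewrite e.
  exact: (map_f fst (mem_tnth i (in_tuple _))).
- by apply: dterm_inj; rewrite /= /hom_assign /assign /= eqxx.
Qed.

Theorem theorem23 (A : countType) (p q r : A) :
  inhabited
    (nat_trans
       (interp' (Imp (Atom p) (Or (Atom q) (Atom r))))
       (interp' (Or (Imp (Atom p) (Atom q)) (Imp (Atom p) (Atom r))))).
Proof. by constructor; apply: exp_coprod; exact: atom_cyclic. Qed.
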